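(* Let $G$ be a countable discrete amenable group, let $\pi:\mathbf{X}\to\mathbf{Y}$ be an extension of measure-preserving $G$-systems, and let $(P_m)_{m=1}^\infty$ be a refining sequence of partitions of $X$ that is generating for $\mathbf{X}$ relative to $\pi$. Then $$h_{\mathrm{slow}}^{U,(F_n)}(\mathbf{X}\,|\,\pi)\ =\ \lim_{m\to\infty}h_{\mathrm{slow}}^{U,(F_n)}(\mathbf{X},P_m\,|\,\pi)\ =\ \sup_m\,h_{\mathrm{slow}}^{U,(F_n)}(\mathbf{X},P_m\,|\,\pi)$$ for every rate function $U$ and every F\o lner sequence $(F_n)$ for $G$.
   Context: A (left) F\o lner sequence for $G$ is a sequence of finite nonempty sets $F_n\subseteq G$ with $|gF_n\cap F_n|/|F_n|\to 1$ for each $g\in G$. A system $\mathbf{X}=(X,\mathcal{B}_X,\mu,T)$ is a measure-preserving action $T=(T^g)_{g\in G}$ (with $T^{gh}=T^gT^h$) on a standard probability space. A factor map (equivalently, an extension) $\pi:\mathbf{X}\to\mathbf{Y}=(Y,\mathcal{B}_Y,\nu,S)$ is a measurable map with $\pi_*\mu=\nu$ and $\pi T^g=S^g\pi$ a.e.; $\mu=\int\mu_y\,d\nu(y)$ denotes the disintegration of $\mu$ over $\pi$. All partitions are finite and measurable. For $P=\{P_0,\dots,P_{r-1}\}$, $P(x)$ is the index $i$ with $x\in P_i$. For $F\subseteq G$, $P^F=\bigvee_{f\in F}T^{f^{-1}}P$; when $F=G$ this is the $\sigma$-algebra generated by all $T^{g^{-1}}P$, $g\in G$. A sequence $(P_m)$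 of partitions is refining if $P_{m+1}$ refines $P_m$ for every $m$, and it is generating for $\mathbf{X}$ relative to $\pi$ if $\left(\bigvee_{m\ge1}P_m^G\right)\vee\pi^{-1}\mathcal{B}_Y=\mathcal{B}_X$ modulo $\mu$-null sets. For finite $F\subseteq G$, $d_{P,F}(x,x')=\frac1{|F|}\sum_{f\in F}1_{P(T^fx)\ne P(T^fx')}$, and $\operatorname{diam}_{P,F}$ is the diameter with respect to this pseudo-metric. For a probability measure $\lambda$ on $X$ and $\epsilon>0$, $\operatorname{cov}(\lambda,P,F,\epsilon)$ is the smallest $M$ such that there exist $E_1,\dots,E_M\subseteq X$ with $\operatorname{diam}_{P,F}(E_i)\le\epsilon$ for all $i$ and $\lambda(\bigcup E_i)\ge1-\epsilon$. The relative covering number is $$\operatorname{cov}(\mu,P,F,\epsilon\,|\,\pi)=\inf_{S'\subseteq Y:\ \nu(S')\ge1-\epsilon}\ \sup_{y\in S'}\operatorname{cov}(\mu_y,P,F,\epsilon).$$ A rate function is an increasing function $U:\mathbb{N}\to(0,\infty)$ with $U(n)\to\infty$. The relative slow entropy is $$h_{\mathrm{slow}}^{U,(F_n)}(\mathbf{X},P\,|\,\pi)=\sup_{\epsilon>0}\limsup_{n\to\infty}\frac{\operatorname{cov}(\mu,P,F_n,\epsilon\,|\,\pi)}{U(|F_n|)},\qquad h_{\mathrm{slow}}^{U,(F_n)}(\mathbf{X}\,|\,\pi)=\sup_P h_{\mathrm{slow}}^{U,(F_n)}(\mathbf{X},P\,|\,\pi),$$ with values in $[0,\infty]$, the last supremum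 being over all partitions $P$ of $X$. *)

(* Defs.v *)
From HB Require Import structures.
From mathcomp Require Import all_boot all_order all_algebra finmap.
From mathcomp Require Import all_classical all_reals all_analysis.

Set Implicit Arguments.
Unset Strict Implicit.
Unset Printing Implicit Defensive.

Import Order.TTheory GRing.Theory Num.Theory.
Import numFieldNormedType.Exports.

Local Open Scope classical_set_scope.
Local Open Scope ring_scope.

Definition folner (R : realType) (G : groupType) (F : nat -> {fset G}) : Prop :=
  (forall n, F n != fset0) /\
  (forall g : G,
     (#|` ([fset (g * f)%g | f in F n] `&` F n)%fset|%:R / #|` F n|%:R : R)
       @[n --> \oo] --> (1 : R)).

Definition amenable (R : realType) (G : groupType) : Prop :=
  exists F : nat -> {fset G}, folner R F.

(* The sigma-algebra of X is, up to a bijection, the Borel sigma-algebra of a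
   Polish space. *)
Definition standard_borel (R : realType) (d : measure_display)
    (X : measurableType d) : Prop :=
  exists S : completePseudoMetricType R,
    [/\ hausdorff_space S, @second_countable S &
        exists f : X -> S, bijective f /\
          @measurable d X = preimage_set_system [set: X] f <<s @open S >>].

Record pmp_action (R : realType) (G : groupType) (d : measure_display)
    (X : measurableType d) (mu : probability X R) := PmpAction {
  act :> G -> X -> X ;
  act1 : forall x, act 1%g x = x ;
  actM : forall g h x, act (g * h)%g x = act g (act h x) ;
  act_measurable : forall g, measurable_fun [set: X] (act g) ;
  act_preserving : forall g (A : set X), measurable A ->
    mu (act g @^-1` A) = mu A }.

Definition factor_map (R : realType) (G : groupType) (dX dY : measure_display)
    (X : measurableType dX) (Y : measurableType dY)
    (mu : probability X R) (nu : probability Y R)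
    (T : pmp_action G mu) (S : pmp_action G nu) (pi : X -> Y) : Prop :=
  [/\ measurable_fun [set: X] pi,
      forall B : set Y, measurable B -> pushforward mu pi B = nu B &
      forall g : G, {ae mu, forall x, pi (T g x) = S g (pi x)}].

(* On standard Borel spaces such a kernel exists and is unique up to a
   nu-null set of y. *)
Definition disintegration (R : realType) (dX dY : measure_display)
    (X : measurableType dX) (Y : measurableType dY)
    (mu : probability X R) (nu : probability Y R) (pi : X -> Y)
    (muY : R.-pker Y ~> X) : Prop :=
  (forall A : set X, measurable A -> mu A = (\int[nu]_y muY y A)%E) /\
  {ae nu, forall y, muY y (pi @^-1` [set y]) = 1%E}.

(* A finite measurable partition {P_0, ..., P_(r-1)}, given by the function
   x |-> P(x); some cells may be empty. *)
Record mpartition (d : measure_display) (X : measurableType d) := MPartition {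
  ncells : nat ;
  label :> X -> 'I_ncells ;
  label_measurable : forall i, measurable (label @^-1` [set i]) }.

Definition cell (d : measure_display) (X : measurableType d)
    (P : mpartition X) (i : 'I_(ncells P)) : set X := P @^-1` [set i].
Arguments cell {d X} P i.

Definition refines (d : measure_display) (X : measurableType d)
    (Q P : mpartition X) : Prop :=
  forall j, exists i, cell Q j `<=` cell P i.

Section SlowEntropy.
Context (R : realType) (G : groupType) (d : measure_display)
  (X : measurableType d) (mu : probability X R) (T : pmp_action G mu).

(* P^G, the sigma-algebra generated by the partitions T^(g^-1) P, g in G. *)
Definition orbit_salgebra (P : mpartition X) : set (set X) :=
  <<s [set A | exists (g : G) (i : 'I_(ncells P)), A = T g^-1%g @` cell P i] >>.

Definition eq_mod_null (S1 S2 : set (set X)) : Prop :=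
  (forall A, S1 A -> exists2 B, S2 B & mu.-negligible (A `+` B)) /\
  (forall B, S2 B -> exists2 A, S1 A & mu.-negligible (A `+` B)).

Definition generating (dY : measure_display) (Y : measurableType dY)
    (pi : X -> Y) (P : nat -> mpartition X) : Prop :=
  eq_mod_null
    <<s (\bigcup_m orbit_salgebra (P m)) `|`
        preimage_set_system [set: X] pi (@measurable dY Y) >>
    (@measurable d X).

Definition hamming (P : mpartition X) (F : {fset G}) (x x' : X) : R :=
  #|` F|%:R^-1 * \sum_(f <- F) (P (T f x) != P (T f x'))%:R.

(* The real supremum of the empty set is 0, so the empty set has diameter 0. *)
Definition diam (P : mpartition X) (F : {fset G}) (E : set X) : R :=
  sup [set hamming P F x x' | x in E & x' in E].

(* An infimum of natural numbers, hence the smallest such M. *)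
Definition cov (lam : {measure set X -> \bar R}) (P : mpartition X)
    (F : {fset G}) (eps : R) : \bar R :=
  ereal_inf [set M%:R%:E | M in [set M : nat |
    exists E : 'I_M -> set X,
      [/\ forall i, measurable (E i),
          forall i, diam P F (E i) <= eps &
          ((1 - eps)%:E <= lam (\bigcup_i E i))%E]]].

Context (dY : measure_display) (Y : measurableType dY) (nu : probability Y R)
  (muY : R.-pker Y ~> X).

(* Suprema are taken in [0, +oo]: the maximum with 0 only matters for S' empty
   (possible when 1 <= eps), where ereal_sup is -oo. *)
Definition rel_cov (P : mpartition X) (F : {fset G}) (eps : R) : \bar R :=
  ereal_inf [set maxe 0%E (ereal_sup [set cov (muY y) P F eps | y in S']) |
    S' in [set S' : set Y | measurable S' /\ ((1 - eps)%:E <= nu S')%E]].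

Definition slow_entropy_part (U : nat -> R) (F : nat -> {fset G})
    (P : mpartition X) : \bar R :=
  ereal_sup [set
    limn_esup (fun n => rel_cov P (F n) eps * ((U #|` F n|)^-1)%:E)%E |
    eps in [set eps : R | 0 < eps]].

Definition slow_entropy (U : nat -> R) (F : nat -> {fset G}) : \bar R :=
  ereal_sup (range (slow_entropy_part U F)).

End SlowEntropy.

Definition rate_function (R : realType) (U : nat -> R) : Prop :=
  [/\ forall n, 0 < U n,
      {homo U : m n / (m <= n)%N >-> m <= n} &
      U n @[n --> \oo] --> +oo].

(* Main.v *)
Require Import Defs.
From HB Require Import structures.
From mathcomp Require Import all_boot all_order all_algebra finmap.
From mathcomp Require Import all_classical all_reals all_analysis.
From mathcomp Require Import measurable_realfun lra.

Import Order.TTheory GRing.Theory Num.Theory.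
Import numFieldNormedType.Exports.
Local Open Scope classical_set_scope.
Local Open Scope ring_scope.

(** The point is to bound, for an arbitrary partition [Q], its relative
    covering numbers by those of some [P m], uniformly along the Folner
    sequence; monotonicity in [m] then turns the supremum into a limit.

    Since the [P m] generate together with the factor, [Q] is determined, off a
    set [D] of measure as small as desired, by the point [pi x] and the
    [P m]-names of [x] along one finite set [H] of the group
    ([partition_code]): the sets that can be approximated by sets so determined
    form a sigma-algebra.  On a single fibre of [pi] the first of these data is
    constant, because the points [T f x] and [T f x'] lie over the same point
    [S f y].  So for [x], [x'] in the fibre, [Q] can tell [T f x] from [T f x']
    only if one of them is in [D], or if [P m] tells [T (h * f) x] from
    [T (h * f) x'] for some [h] in [H].  Averaging over [f] in [F] and replacing
    [hF] by [F], which costs the proportion of [hF] lying outside [F], gives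
    ([hamming_code])

      d_(Q,F) <= (visits of both orbits to D)
                 + #|H| * (d_(P m,F) + Folner error).

    The frequency of visits to [D] has integral [mu D], so by Markov's
    inequality it is small outside a small set [B], and by Markov's inequality
    again [B] is small in most fibres ([visits_small], [fibers_small]).  Hence
    the pieces of a cover that is good for [P m] in such a fibre become, after
    removing [B], a cover that is good for [Q]
    ([rel_cov_fiber_code]). *)

Set Implicit Arguments.
Unset Strict Implicit.

(** * Hamming distances and coding *)

Lemma le_sum_seq (R : realType) (I : eqType) (s : seq I) (a b : I -> R) :
  {in s, forall i, a i <= b i} -> \sum_(i <- s) a i <= \sum_(i <- s) b i.
Proof. by move=> ab; rewrite 2!big_seq ler_sum// => i /ab. Qed.

Section Hamming.
Context (R : realType) (G : groupType) (d : measure_display)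
  (X : measurableType d) (mu : probability X R) (T : pmp_action G mu).
Implicit Types (P Q : mpartition X) (F : {fset G}).

Lemma hamming_le1 P F x x' : F != fset0 -> hamming T P F x x' <= 1.
Proof.
move=> F0; have F1 : 0 < #|` F|%:R :> R by rewrite ltr0n cardfs_gt0.
rewrite /hamming ler_pdivrMl// mulr1.
apply: (@le_trans _ _ (\sum_(f <- F) 1)).
  by apply: le_sum_seq => f _; case: (_ != _).
by rewrite big_const_seq count_predT iter_addr_0.
Qed.

(** The supremum defining [diam] is over a set bounded by 1; without that bound
    [sup] would carry no information. *)
Lemma hamming_le_diam P F (E : set X) x x' : F != fset0 -> E x -> E x' ->
  hamming T P F x x' <= diam T P F E.
Proof.
move=> F0 Ex Ex'; apply: ub_le_sup; last by exists x => //; exists x'.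
by exists 1 => _ [u _ [v _ <-]]; exact: hamming_le1.
Qed.

Lemma diam_le P F (E : set X) (e : R) : 0 <= e ->
  (forall x x', E x -> E x' -> hamming T P F x x' <= e) -> diam T P F E <= e.
Proof.
move=> e0 Ee; rewrite /diam.
have [->|/set0P H0] := eqVneq [set hamming T P F x x' | x in E & x' in E] set0.
  by rewrite sup0.
by apply: ge_sup => // _ [u Eu [v Ev <-]]; exact: Ee.
Qed.

Lemma card_ltranslate (h : G) F : #|` [fset (h * f)%g | f in F]%fset| = #|` F|.
Proof. by rewrite card_imfset//=; exact: mulgI. Qed.

(** Translating [F] to [hF] leaves the terms indexed by both sets unchanged; the
    others number at most [#|hF| - #|hF :&: F|], and each is at most 1. *)
Lemma sum_ltranslate (h : G) F (c : G -> R) :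
  (forall g, 0 <= c g <= 1) ->
  \sum_(f <- F) c (h * f)%g <=
    \sum_(f <- F) c f +
    (#|` F|%:R - #|` ([fset (h * f)%g | f in F] `&` F)%fset|%:R).
Proof.
move=> c01; set hF := [fset (h * f)%g | f in F]%fset.
have -> : \sum_(f <- F) c (h * f)%g = \sum_(f <- hF) c f.
  by rewrite big_imfset//= => f g _ _; exact: mulgI.
rewrite (big_fsetID _ (mem F)) /=.
have card_out : #|` [fset x in hF | x \notin F]|%fset%:R =
    #|` F|%:R - #|` (hF `&` F)%fset|%:R :> R.
  rewrite -(card_ltranslate h F) -/hF -(cardfsID F hF) natrD addrAC subrr add0r.
  by congr (_%:R); congr (#|` _|); apply/fsetP => g; rewrite !inE andbC.
apply: lerD.
  rewrite [leRHS](big_fsetID _ (mem hF)) /=.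
  have -> : [fset x in F | x \in hF]%fset = [fset x in hF | x \in F]%fset.
    by apply/fsetP => g; rewrite !inE andbC.
  rewrite lerDl; apply: sumr_ge0 => g _; by have /andP[] := c01 g.
rewrite -card_out.
apply: (@le_trans _ _ (\sum_(f <- [fset x in hF | x \notin F]%fset) 1)).
  by apply: le_sum_seq => g _; have /andP[] := c01 g.
by rewrite big_const_seq count_predT iter_addr_0.
Qed.

Definition visits F (D : set X) (x : X) : R :=
  #|` F|%:R^-1 * \sum_(f <- F) \1_D (T f x).

Definition folner_ratio F (h : G) : R :=
  #|` ([fset (h * f)%g | f in F] `&` F)%fset|%:R / #|` F|%:R.

(** If the [P]-names along [H] decode [Q] at the times when both orbits avoid
    [D], then a disagreement of [Q] at time [f] is charged either to a visit to
    [D] or to a disagreement of [P] at a time [h * f] with [h] in [H].  The sum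
    of the latter over [f] is compared with the Hamming distance for [P] by
    [sum_ltranslate]: each [h] costs [e] for that distance and [e] for the part
    of [hF] outside [F]. *)
Lemma hamming_code Q P (H : {fset G}) F (D : set X) (e t : R) x x' :
  F != fset0 ->
  (forall f, f \in F -> ~ D (T f x) -> ~ D (T f x') ->
    (forall h, h \in H -> P (T h (T f x)) = P (T h (T f x'))) ->
    Q (T f x) = Q (T f x')) ->
  (forall h, h \in H -> 1 - folner_ratio F h <= e) ->
  visits F D x <= t -> visits F D x' <= t -> hamming T P F x x' <= e ->
  hamming T Q F x x' <= t + t + (e + e) *+ #|` H|.
Proof.
move=> F0 QP He xt x't Pe.
have F1 : 0 < #|` F|%:R :> R by rewrite ltr0n cardfs_gt0.
pose c g : R := (P (T g x) != P (T g x'))%:R.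
have c01 g : 0 <= c g <= 1 by rewrite /c; case: (_ != _); rewrite lexx ler01.
have pointwise f : f \in F -> (Q (T f x) != Q (T f x'))%:R <=
    \1_D (T f x) + \1_D (T f x') + \sum_(h <- H) c (h * f)%g.
  move=> fF; have H0 : 0 <= \sum_(h <- H) c (h * f)%g.
    by apply: sumr_ge0 => h _; have /andP[] := c01 (h * f)%g.
  rewrite !indicE; have [Dx|Dx] := boolP (T f x \in D).
    by rewrite !ler_wpDr//; case: (_ != _).
  have [Dx'|Dx'] := boolP (T f x' \in D).
    by rewrite add0r ler_wpDr//; case: (_ != _).
  rewrite !add0r.
  have [/allP HP|/allPn[h hH hP]] :=
      boolP (all (fun h => P (T h (T f x)) == P (T h (T f x'))) H).
    rewrite QP ?eqxx//; [by move/mem_set/(negP Dx)|by move/mem_set/(negP Dx')|].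
    by move=> h /HP/eqP.
  rewrite (big_fsetD1 _ hH)/= {1}/c !actM hP.
  rewrite ler_wpDr//; last by case: (_ != _).
  by apply: sumr_ge0 => g _; have /andP[] := c01 (g * f)%g.
have code_h h : h \in H -> #|` F|%:R^-1 * (\sum_(f <- F) c (h * f)%g) <= e + e.
  move=> hH; apply: (@le_trans _ _ (#|` F|%:R^-1 * (\sum_(f <- F) c f +
    (#|` F|%:R - #|` ([fset (h * f)%g | f in F] `&` F)%fset|%:R)))).
    by rewrite ler_wpM2l ?invr_ge0 ?ler0n// sum_ltranslate.
  rewrite mulrDr lerD//; apply: le_trans (He h hH).
  by rewrite mulrBr mulVf ?gt_eqF// /folner_ratio mulrC.
apply: (@le_trans _ _ (visits F D x + visits F D x' +
   \sum_(h <- H) (#|` F|%:R^-1 * \sum_(f <- F) c (h * f)%g))).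
  rewrite -mulr_sumr exchange_big/= -!mulrDr -!big_split/=.
  by rewrite ler_wpM2l ?invr_ge0 ?ler0n//; exact: le_sum_seq.
rewrite !lerD//; apply: (@le_trans _ _ (\sum_(h <- H) (e + e))).
  exact: le_sum_seq.
by rewrite big_const_seq count_predT iter_addr_0.
Qed.

End Hamming.

(** * Comparison of covering numbers *)

Lemma limn_esup_le_near (R : realType) (u v : (\bar R)^nat) :
  (\forall n \near \oo, (u n <= v n)%E) -> (limn_esup u <= limn_esup v)%E.
Proof.
move=> uv; rewrite /limn_esup !limf_esupE.
apply: le_ereal_inf_tmp => _ [V Voo <-].
pose W := V `&` [set n | (u n <= v n)%E].
apply: (@le_trans _ _ (ereal_sup (u @` W))).
  by apply: ereal_inf_lbound; exists W => //; exact: filterI.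
apply: ge_ereal_sup => _ [n [Vn uvn] <-].
by apply: le_ereal_sup_tmp; exists (v n) => //; exists n.
Qed.

Section Covering.
Context (R : realType) (G : groupType) (dX dY : measure_display)
  (X : measurableType dX) (Y : measurableType dY)
  (mu : probability X R) (nu : probability Y R) (T : pmp_action G mu)
  (muY : R.-pker Y ~> X).
Implicit Types (P Q : mpartition X) (F : {fset G}).

(** A cover for [P] is turned into a cover for [Q] by cutting every piece with
    the set [W] on which the two Hamming distances are comparable; the loss of
    mass is at most [eta]. *)
Lemma cov_le_cov (lam : {measure set X -> \bar R}) P Q F (W : set X)
    (e e' eta : R) : F != fset0 -> 0 <= e -> measurable W ->
  (lam (~` W) <= eta%:E)%E -> eta + e' <= e ->
  (forall x x', W x -> W x' ->
     hamming T P F x x' <= e' -> hamming T Q F x x' <= e) ->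
  (cov T lam Q F e <= cov T lam P F e')%E.
Proof.
move=> F0 e0 mW lamW etae PQ.
apply: le_ereal_inf_tmp => _ [M [E [mE dE lamE]] <-].
apply: ereal_inf_lbound; exists M => //; exists (fun i => E i `&` W); split.
- by move=> i; exact: measurableI.
- move=> i; apply: diam_le => // x x' [Ex Wx] [Ex' Wx']; apply: PQ => //.
  by apply: le_trans (dE i); exact: hamming_le_diam.
have mU : measurable (\bigcup_i E i) by apply: fin_bigcup_measurable.
have EU : \bigcup_i E i `<=` (\bigcup_i (E i `&` W)) `|` ~` W.
  move=> x [i _ Ex]; have [Wx|nWx] := pselect (W x); last by right.
  by left; exists i.
have mUW : measurable (\bigcup_i (E i `&` W)).
  by apply: fin_bigcup_measurable => // i _; exact: measurableI.
have : ((1 - e')%:E <= lam (\bigcup_i (E i `&` W)) + eta%:E)%E.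
  apply: (le_trans lamE); apply: (le_trans (le_measure lam _ _ EU)).
  - by rewrite inE.
  - by rewrite inE; apply: measurableU => //; exact: measurableC.
  apply: (le_trans (measureU2 _ _ _)) => //; first exact: measurableC.
  by rewrite leeD2l.
rewrite -leeBlDr//; apply: le_trans.
by rewrite -EFinB lee_fin -addrA lerD2l -opprD lerN2 addrC.
Qed.

Lemma rel_cov_le_rel_cov P Q F (Z : set Y) (e e' eta : R) : measurable Z ->
  (nu (~` Z) <= eta%:E)%E -> eta + e' <= e ->
  (forall y, Z y -> cov T (muY y) Q F e <= cov T (muY y) P F e')%E ->
  (rel_cov T nu muY Q F e <= rel_cov T nu muY P F e')%E.
Proof.
move=> mZ nuZ etae PQ; apply: le_ereal_inf_tmp => _ [S' [mS nuS] <-].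
apply: (@le_trans _ _ (maxe 0%E
    (ereal_sup [set cov T (muY y) Q F e | y in S' `&` Z]))).
  apply: ereal_inf_lbound; exists (S' `&` Z) => //; split.
    exact: measurableI.
  have : ((1 - e')%:E <= nu (S' `&` Z) + eta%:E)%E.
    have mSZ : measurable (S' `&` Z) by exact: measurableI.
    have mZC : measurable (~` Z) by exact: measurableC.
    have SZ : S' `<=` (S' `&` Z) `|` ~` Z.
      by move=> y Sy; have [Zy|nZy] := pselect (Z y); [left|right].
    apply: (le_trans nuS); apply: (le_trans (le_measure nu _ _ SZ)).
    - by rewrite inE.
    - by rewrite inE; exact: measurableU.
    by apply: (le_trans (measureU2 _ _ _)) => //; rewrite leeD2l.
  rewrite -leeBlDr//; apply: le_trans.
  by rewrite -EFinB lee_fin -addrA lerD2l -opprD lerN2 addrC.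
apply: le_max2 => //; apply: ge_ereal_sup => _ [y [Sy Zy] <-].
apply: le_ereal_sup_tmp; exists (cov T (muY y) P F e'); last exact: PQ.
by exists y.
Qed.

(** The comparison partition may depend on [e], the supremum over [e] being
    outermost: this is what lets [m] grow as [e] shrinks. *)
Lemma slow_entropy_part_le (U : nat -> R) (F : nat -> {fset G}) Q (M : \bar R) :
  (forall n, 0 < U n) ->
  (forall e : R, 0 < e -> exists P (e' : R),
    [/\ 0 < e', (slow_entropy_part T nu muY U F P <= M)%E &
      \forall n \near \oo,
        (rel_cov T nu muY Q (F n) e <= rel_cov T nu muY P (F n) e')%E]) ->
  (slow_entropy_part T nu muY U F Q <= M)%E.
Proof.
move=> U0 PQ; apply: ge_ereal_sup => _ [e /= e0 <-].
have [P [e' [e'0 PM near_le]]] := PQ e e0; apply: le_trans PM.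
apply: le_ereal_sup_tmp; eexists; first by exists e'.
apply: limn_esup_le_near; apply: filterS near_le => n le_n.
by apply: lee_wpmul2r le_n; rewrite lee_fin invr_ge0 ltW.
Qed.

Lemma refines_eq P Q x x' : refines Q P -> Q x = Q x' -> P x = P x'.
Proof.
move=> /(_ (Q x))[i QPi] Qxx'.
have /= -> : cell P i x by exact: QPi.
by have /= -> : cell P i x' by apply: QPi; rewrite /cell/= -Qxx'.
Qed.

Lemma slow_entropy_part_refines (U : nat -> R) (F : nat -> {fset G}) P Q :
  (forall n, 0 < U n) -> (forall n, F n != fset0) -> refines P Q ->
  (slow_entropy_part T nu muY U F Q <= slow_entropy_part T nu muY U F P)%E.
Proof.
move=> U0 F0 PQ; apply: slow_entropy_part_le => // e e0; exists P, e; split=> //.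
apply: nearW => n; apply: (rel_cov_le_rel_cov (Z := setT) (eta := 0)) => //.
- by rewrite setCT measure0.
- by rewrite add0r.
move=> y _; apply: (cov_le_cov (W := setT) (eta := 0)) => //.
- exact: ltW.
- by rewrite setCT measure0.
- by rewrite add0r.
move=> x x' _ _; apply: le_trans.
rewrite /hamming ler_wpM2l ?invr_ge0 ?ler0n//; apply: le_sum_seq => f _.
have [/(refines_eq PQ) ->|_] := eqVneq (P (T f x)) (P (T f x')).
  by rewrite eqxx.
by case: (_ != _).
Qed.

End Covering.

(** * Coding a partition by a generating sequence *)

Section Coding.
Context (R : realType) (G : groupType) (dX dY : measure_display)
  (X : measurableType dX) (Y : measurableType dY)
  (mu : probability X R) (T : pmp_action G mu) (pi : X -> Y)
  (P : nat -> mpartition X).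
Hypothesis P_refining : forall m, refines (P m.+1) (P m).
Hypothesis pi_measurable : measurable_fun [set: X] pi.
Implicit Types (m : nat) (H : {fset G}) (A B D : set X).

(** The information that the factor and a finite window of [P m]-names give
    about a point. *)
Definition same_name m H x x' :=
  pi x = pi x' /\ forall h, h \in H -> P m (T h x) = P m (T h x').

Definition coded m H A := forall x x', same_name m H x x' -> A x -> A x'.

(** Up to null sets these are the members of the sigma-algebra generated by the
    coded sets; approximability is used because it only ever involves one [m]
    and one finite [H], as the coding of a partition requires. *)
Definition codable A := measurable A /\ forall e : R, 0 < e ->
  exists m H A', [/\ measurable A', coded m H A' & (mu (A `+` A') <= e%:E)%E].

Lemma refines_le m m' x x' : (m <= m')%N -> P m' x = P m' x' -> P m x = P m x'.
Proof.
elim: m' => [|m' IH]; first by rewrite leqn0 => /eqP ->.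
rewrite leq_eqVlt => /predU1P[-> //|/IH mm'] Pxx'; apply: mm'.
exact: (refines_eq (@P_refining m')).
Qed.

Lemma same_name_le m m' H H' x x' : (m <= m')%N -> (H `<=` H')%fset ->
  same_name m' H' x x' -> same_name m H x x'.
Proof.
move=> mm' /fsubsetP HH' [pixx' sn]; split=> // h /HH' /sn.
exact: refines_le.
Qed.

Lemma same_name_sym m H x x' : same_name m H x x' -> same_name m H x' x.
Proof. by move=> [? sn]; split=> // h /sn. Qed.

Lemma measurable_setY A B :
  measurable A -> measurable B -> measurable (A `+` B).
Proof.
by move=> mA mB; rewrite setY_def; apply: measurableU; exact: measurableD.
Qed.

Lemma mu_le_add A B D (a b : R) :
  measurable A -> measurable B -> measurable D ->
  D `<=` A `|` B -> (mu A <= a%:E)%E -> (mu B <= b%:E)%E ->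
  (mu D <= (a + b)%:E)%E.
Proof.
move=> mA mB mD DAB Aa Bb; apply: (le_trans (le_measure mu _ _ DAB)).
- by rewrite inE.
- by rewrite inE; exact: measurableU.
by apply: (le_trans (measureU2 mu mA mB)); rewrite EFinD leeD.
Qed.

Lemma codable_coded m H A : measurable A -> coded m H A -> codable A.
Proof.
move=> mA cA; split=> // e e0; exists m, H, A; split=> //.
by rewrite setYK measure0 lee_fin ltW.
Qed.

Lemma codableC A : codable A -> codable (~` A).
Proof.
move=> [mA cA]; split=> [|e e0]; first exact: measurableC.
have [m [H [A' [mA' cA' AA']]]] := cA e e0.
exists m, H, (~` A'); split; first exact: measurableC.
  by move=> x x' /same_name_sym xx' nA'x /(cA' _ _ xx').
suff -> : ~` A `+` ~` A' = A `+` A' by [].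
by rewrite !setY_def !setDE !setCK setUC [A' `&` _]setIC [_ `&` A]setIC.
Qed.

(** Here the refining hypothesis enters: two codes are merged into one by taking
    the larger index and the union of the windows ([same_name_le]). *)
Lemma codableU A B : codable A -> codable B -> codable (A `|` B).
Proof.
move=> [mA cA] [mB cB]; split=> [|e e0]; first exact: measurableU.
have e20 : 0 < e / 2 by rewrite divr_gt0.
have [m [H [A' [mA' cA' AA']]]] := cA _ e20.
have [n [K [B' [mB' cB' BB']]]] := cB _ e20.
exists (maxn m n), (H `|` K)%fset, (A' `|` B'); split; first exact: measurableU.
  move=> x x' xx' [A'x|B'x].
    left; apply: cA' A'x; apply: same_name_le xx'; first exact: leq_maxl.
    exact: fsubsetUl.
  right; apply: cB' B'x; apply: same_name_le xx'; first exact: leq_maxr.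
  exact: fsubsetUr.
rewrite [e]splitr; apply: mu_le_add AA' BB'; try exact: measurable_setY.
  by apply: measurable_setY; exact: measurableU.
rewrite !setY_def => x [[[Ax|Bx] nA'B']|[[A'x|B'x] nAB]].
- by left; left; split=> // A'x; apply: nA'B'; left.
- by right; left; split=> // B'x; apply: nA'B'; right.
- by left; right; split=> // Ax; apply: nAB; left.
- by right; right; split=> // Bx; apply: nAB; right.
Qed.

Lemma codable0 : codable set0.
Proof. exact: (@codable_coded 0%N fset0). Qed.

(** The tail of a countable union beyond its first [N] members decreases to the
    empty set, so it has measure at most [e / 2] for some [N], and the finite
    union that is left is approximated within the other half of [e]. *)
Lemma codable_bigcup (A : (set X)^nat) :
  (forall n, codable (A n)) -> codable (\bigcup_n A n).
Proof.
move=> cA; have mU : measurable (\bigcup_n A n).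
  by apply: bigcup_measurable => n _; have [] := cA n.
split=> // e e0; have e20 : 0 < e / 2 by rewrite divr_gt0.
pose S n := \big[setU/set0]_(k < n) A k.
have cS n : codable (S n).
  rewrite /S; elim/big_ind : _ => [|B D|i _]; first exact: codable0.
    exact: codableU.
  exact: cA.
pose tail n := (\bigcup_k A k) `\` S n.
have mtail n : measurable (tail n) by apply: measurableD => //; have [] := cS n.
have tail0 : \bigcap_n tail n = set0.
  apply/seteqP; split=> // x tailx; have [[k _ Akx] _] := tailx 0%N I.
  have [_] := tailx k.+1 I; apply; rewrite /S -bigcup_mkord.
  by exists k => /=.
have tail_cvg : (mu \o tail) n @[n --> \oo] --> mu set0.
  rewrite -tail0; apply: nonincreasing_cvg_mu => //.
  - by rewrite (le_lt_trans (probability_le1 mu _)) ?ltry.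
  - by rewrite tail0.
  - move=> n n' nn'; apply/subsetPset; apply: setDS; rewrite /S.
    exact: subset_bigsetU.
have [N tailN] : exists N, (mu (tail N) <= (e / 2)%:E)%E.
  have mu0 : (mu set0 < (e / 2)%:E)%E by rewrite measure0 lte_fin.
  have [N _ /(_ N (leqnn N)) /= /ltW] := tail_cvg _ (open_ereal_lt' mu0).
  by exists N.
have [mS /(_ _ e20) [m [H [A' [mA' cA' SA']]]]] := cS N.
exists m, H, A'; split=> //.
rewrite [e]splitr; apply: (mu_le_add (A := tail N) (B := S N `+` A')) => //;
  try exact: measurable_setY.
move=> x; rewrite !setY_def => -[[Ax nA'x]|[A'x nAx]].
  by have [Sx|nSx] := pselect (S N x); [right; left|left].
right; right; split=> // Sx; apply: nAx; move: Sx; rewrite /S -bigcup_mkord.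
by move=> [k _ Akx]; exists k.
Qed.

Lemma codable_sigma_algebra : sigma_algebra [set: X] codable.
Proof.
split; [exact: codable0| |exact: codable_bigcup].
by move=> A cA; rewrite setTD; exact: codableC.
Qed.

Lemma codable_cell g m (i : 'I_(ncells (P m))) :
  codable (T g^-1%g @` cell (P m) i).
Proof.
have -> : T g^-1%g @` cell (P m) i = T g @^-1` cell (P m) i.
  apply/seteqP; split=> [_ [x Px <-]|x Px] /=.
    by rewrite -actM mulgV act1.
  by exists (T g x) => //; rewrite -actM mulVg act1.
apply: (@codable_coded m [fset g]%fset).
  rewrite -[X in measurable X]setTI; apply: act_measurable => //.
  exact: label_measurable.
move=> x x' [_ /(_ g)]; rewrite inE eqxx => /(_ isT) /= xx' <-.
by rewrite xx'.
Qed.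

Lemma codable_preimage (B : set Y) : measurable B -> codable (pi @^-1` B).
Proof.
move=> mB; apply: (@codable_coded 0%N fset0).
  by rewrite -[X in measurable X]setTI; exact: pi_measurable.
by move=> x x' [/= ->].
Qed.

Lemma codable_measurable : generating T pi P ->
  forall A, measurable A -> codable A.
Proof.
move=> [_ gen] A mA; have [B sB AB] := gen A mA.
have [mB cB] : codable B.
  apply: smallest_sub sB; first exact: codable_sigma_algebra.
  move=> C [[m _]|[D mD <-]]; last by rewrite setTI; exact: codable_preimage.
  apply: smallest_sub; first exact: codable_sigma_algebra.
  by move=> _ [g [i ->]]; exact: codable_cell.
split=> // e e0; have [m [H [A' [mA' cA' BA']]]] := cB e e0.
exists m, H, A'; split=> //; have [N [mN N0 ABN]] := AB.
rewrite -[e]add0r; apply: (mu_le_add (A := N) (B := B `+` A')) => //;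
  try exact: measurable_setY.
  move=> x AA'x; have [Nx|nNx] := pselect (N x); [by left|right].
  have nAB : ~ (B `+` A) x by move/ABN.
  move: AA'x nAB; rewrite !setY_def.
  have [Bx|Bx] := pselect (B x); have [Ax|Ax] := pselect (A x);
    have [A'x|A'x] := pselect (A' x) => /=; tauto.
by rewrite N0.
Qed.

(** The exceptional set is the union over the cells of [Q] of the symmetric
    differences between the cell and a coded approximation.  Off this set,
    belonging to a cell and belonging to its approximation are the same, and the
    latter is seen from the name. *)
Lemma partition_code (Q : mpartition X) (e : R) : generating T pi P -> 0 < e ->
  exists m H D, [/\ measurable D, (mu D <= e%:E)%E &
    forall x x', ~ D x -> ~ D x' -> same_name m H x x' -> Q x = Q x'].
Proof.
move=> gen e0.
(* Cells are treated one at a time, so that the codes of two cells are merged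
   at each step and the error is halved. *)
have code_cells (s : seq 'I_(ncells Q)) (e' : R) : 0 < e' ->
    exists m H D, [/\ measurable D, (mu D <= e'%:E)%E &
      forall i x x', i \in s -> ~ D x -> ~ D x' -> same_name m H x x' ->
        Q x = i -> Q x' = i].
  elim: s e' => [|i s IH] e' e'0.
    exists 0%N, fset0, set0; split=> //.
    by rewrite measure0 lee_fin ltW.
  have e'20 : 0 < e' / 2 by rewrite divr_gt0.
  have [m [H [D [mD De QD]]]] := IH _ e'20.
  have [mQi /(_ _ e'20) [n [K [A [mA cA QA]]]]] :=
    codable_measurable gen (label_measurable (m:=Q) i).
  exists (maxn m n), (H `|` K)%fset, (D `|` ((Q @^-1` [set i]) `+` A)); split.
  - by apply: measurableU => //; exact: measurable_setY.
  - rewrite [e']splitr; apply: mu_le_add De QA => //; try exact: measurable_setY.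
    by apply: measurableU => //; exact: measurable_setY.
  move=> j x x' /[!inE] /predU1P[->|js] nDx nDx' xx' Qx; last first.
    apply: QD Qx => //.
    - by move=> Dx; apply: nDx; left.
    - by move=> Dx; apply: nDx'; left.
    by apply: same_name_le xx'; [exact: leq_maxl|exact: fsubsetUl].
  have Ax : A x.
    apply: contrapT => nAx; apply: nDx; right.
    by rewrite setY_def; left.
  have Ax' : A x'.
    apply: cA Ax; apply: same_name_le xx'; [exact: leq_maxr|exact: fsubsetUr].
  apply: contrapT => nQx'; apply: nDx'; right.
  by rewrite setY_def; right.
have [m [H [D [mD De QD]]]] := code_cells (enum 'I_(ncells Q)) e e0.
exists m, H, D; split=> // x x' nDx nDx' xx'.
by apply/esym/(QD (Q x) x); rewrite ?mem_enum.
Qed.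

End Coding.

(** * Exceptional sets: frequency of visits, equivariance, fibres *)

Section Markov.
Context (R : realType).

Lemma markov_ge d (Z : measurableType d) (lam : {measure set Z -> \bar R})
    (f : Z -> \bar R) (a : R) : measurable_fun [set: Z] f ->
  (forall z, 0 <= f z)%E -> 0 < a ->
  (a%:E * lam [set z | (a%:E <= f z)%E] <= \int[lam]_z f z)%E.
Proof.
move=> mf f0 a0.
have := @le_integral_comp_abse _ _ _ lam _ measurableT f a id.
have -> : [set z | (a%:E <= `|f z|)%E] = [set z | (a%:E <= f z)%E].
  by apply/seteqP; split=> z /=; rewrite gee0_abs.
rewrite setTI (eq_integral f) => [H|z _]; last by rewrite gee0_abs.
by apply: H.
Qed.

Context (G : groupType) (dX dY : measure_display)
  (X : measurableType dX) (Y : measurableType dY)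
  (mu : probability X R) (nu : probability Y R)
  (T : pmp_action G mu) (S : pmp_action G nu) (pi : X -> Y)
  (muY : R.-pker Y ~> X).

(** By invariance of [mu] the frequency of visits to [D] along [F] has integral
    [mu D], whatever [F]; Markov's inequality does the rest. *)
Lemma visits_small (F : {fset G}) (D : set X) (t c : R) :
  F != fset0 -> measurable D -> 0 < t -> (mu D <= (t * c)%:E)%E ->
  exists B, [/\ measurable B, (mu B <= c%:E)%E &
    forall x, ~ B x -> visits T F D x <= t].
Proof.
move=> F0 mD t0 muD; have F1 : 0 < #|` F|%:R :> R by rewrite ltr0n cardfs_gt0.
have mTD f : measurable (T f @^-1` D).
  by rewrite -[X in measurable X]setTI; exact: act_measurable.
pose v x : \bar R := (\sum_(f <- F) (\1_(T f @^-1` D) x)%:E)%E.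
have mind f :
    measurable_fun [set: X] (fun x => (\1_(T f @^-1` D) x)%:E : \bar R).
  by apply/measurable_EFinP; exact: measurable_indic.
have mv : measurable_fun [set: X] v by exact: emeasurable_sum.
have v0 x : (0 <= v x)%E by apply: sume_ge0 => f _; rewrite lee_fin indicE.
have intv : (\int[mu]_x v x = #|` F|%:R%:E * mu D)%E.
  rewrite ge0_integral_sum//.
  rewrite (eq_bigr (fun=> mu D)) => [|f _]; last first.
    by rewrite integral_indic// setIT; exact: act_preserving.
  by rewrite big_const_seq count_predT iter_addr_0 mule_natl.
pose a := t * #|` F|%:R; have a0 : 0 < a by rewrite mulr_gt0.
exists [set x | (a%:E <= v x)%E]; split.
- by rewrite -[X in measurable X]setTI; exact: emeasurable_fun_c_infty.
- have := markov_ge mu mv v0 a0.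
  rewrite intv => /le_trans/(_ (lee_wpmul2l _ muD)).
  rewrite lee_fin ltW// => /(_ isT); rewrite -EFinM mulrA [_ * t]mulrC -/a EFinM.
  by rewrite lee_pmul2l.
move=> x /negP; rewrite -ltNge /visits ler_pdivrMl// [_ * t]mulrC -/a => /ltW.
by rewrite /v sumEFin lee_fin.
Qed.

Lemma equivariant_finite (F : {fset G}) : factor_map T S pi ->
  exists N, [/\ measurable N, mu N = 0%E &
    forall x, ~ N x -> forall f, f \in F -> pi (T f x) = S f (pi x)].
Proof.
move=> [_ _ piT].
have eq_seq (s : seq G) : exists N, [/\ measurable N, mu N = 0%E &
    forall x, ~ N x -> forall f, f \in s -> pi (T f x) = S f (pi x)].
  elim: s => [|g s [N [mN N0 NT]]]; first by exists set0.
  have [M [mM M0 MT]] := piT g.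
  exists (N `|` M); split; [exact: measurableU|by rewrite measureU0|].
  move=> x nNM f /[!inE] /predU1P[->|fs].
    by apply: contrapT => nT; apply: nNM; right; exact: MT.
  by apply: NT => // Nx; apply: nNM; left.
exact: eq_seq.
Qed.

(** With [mu B <= c * c], Markov's inequality for [y |-> muY y B], whose
    integral is [mu B], leaves out a set of measure at most [c].  For almost every other
    [y] the measure [muY y] also lives on the fibre over [y], so intersecting
    with the fibre loses nothing. *)
Lemma fibers_small (B : set X) (c : R) :
  disintegration mu nu pi muY -> (forall y : Y, measurable [set y]) ->
  measurable_fun [set: X] pi ->
  measurable B -> 0 < c -> (mu B <= (c * c)%:E)%E ->
  exists Z, [/\ measurable Z, (nu (~` Z) <= c%:E)%E &
    forall y, Z y -> (muY y (~` (~` B `&` pi @^-1` [set y])) <= c%:E)%E].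
Proof.
move=> [dis [N [mN N0 fibN]]] mset1 mpi mB c0 muB.
have mk : measurable_fun [set: Y] (fun y => muY y B) by exact: measurable_kernel.
pose V := [set y | (c%:E <= muY y B)%E].
have mV : measurable V.
  by rewrite -[X in measurable X]setTI; exact: emeasurable_fun_c_infty.
exists (~` (V `|` N)); split; first exact/measurableC/measurableU.
- rewrite setCK measureU0//.
  have := markov_ge nu mk (fun=> measure_ge0 _ _) c0.
  by rewrite -dis// => /le_trans/(_ muB); rewrite EFinM lee_pmul2l.
move=> y /not_orP[/negP]; rewrite -ltNge => yB nNy.
have fib1 : muY y (pi @^-1` [set y]) = 1%E.
  by apply: contrapT => nfib; apply: nNy; exact: fibN.
have mfib : measurable (pi @^-1` [set y]).
  by rewrite -[X in measurable X]setTI; exact: mpi.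
have cofib0 : muY y (~` (pi @^-1` [set y])) = 0%E.
  have := @prob_kernel _ _ _ _ _ muY y; rewrite -(setUv (pi @^-1` [set y])).
  rewrite measureU ?setICr//; last exact: measurableC.
  rewrite [X in (X + _)%E]fib1 addeC => fibE.
  by rewrite -(@addeK _ 1%E (muY y _))// [X in (X - _)%E]fibE subee.
rewrite setCI setCK measureU0//; [exact: ltW|exact: measurableC].
Qed.

End Markov.

(** Makes the fibres of a factor map measurable: in a Hausdorff space points are
    closed, and the bijection with [Y] carries them back to points. *)
Lemma standard_borel_measurable_set1 (R : realType) (d : measure_display)
  (Y : measurableType d) :
  standard_borel R Y -> forall y : Y, measurable [set y].
Proof.
move=> [S [hS _ [f [[g fK gK] mY]]]] y.
have -> : [set y] = [set: Y] `&` f @^-1` [set f y].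
  by rewrite setTI; apply/seteqP; split=> [_ -> //|z /(can_inj fK)].
rewrite mY; exists [set f y] => //.
rewrite -[X in <<s _ >> X]setCK -[X in <<s _ >> X]setTD.
apply: sigma_algebraCD; apply: sub_sigma_algebra.
by apply: closed_openC; exact/accessible_closed_set1/hausdorff_accessible.
Qed.

(** * Relative slow entropy along a generating sequence *)

Section Generating.
Context (R : realType) (G : groupType) (dX dY : measure_display)
  (X : measurableType dX) (Y : measurableType dY)
  (mu : probability X R) (nu : probability Y R)
  (T : pmp_action G mu) (S : pmp_action G nu) (pi : X -> Y)
  (muY : R.-pker Y ~> X).

Lemma folner_near (F : nat -> {fset G}) (H : {fset G}) (e : R) :
  folner R F -> 0 < e ->
  \forall n \near \oo, forall h, h \in H -> 1 - folner_ratio R (F n) h <= e.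
Proof.
move=> [_ folF] e0.
suff near_seq (s : seq G) :
    \forall n \near \oo, forall h, h \in s -> 1 - folner_ratio R (F n) h <= e.
  exact: near_seq.
elim: s => [|g s IH]; first exact: nearW.
have near_g : \forall n \near \oo, 1 - e <= folner_ratio R (F n) g.
  by apply: cvgr_ge (folF g) _ _; rewrite gtrBl.
apply: filterS2 IH near_g => n IH gn h /[!inE] /predU1P[->|/IH //].
by rewrite lerBlDr addrC -lerBlDr.
Qed.

(** On the fibre over [y], equivariance puts [T f x] and [T f x'] over the same
    point [S f y]; the hypothesis that [Q] is coded by [pi] and the [P]-names
    therefore reduces to the [P]-names alone, and [hamming_code] applies outside
    the exceptional sets. *)
Lemma rel_cov_fiber_code (P Q : mpartition X) (F H : {fset G}) (D : set X)
    (t c e e' : R) :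
  factor_map T S pi -> disintegration mu nu pi muY ->
  (forall y : Y, measurable [set y]) ->
  F != fset0 -> 0 < t -> 0 < c -> 0 <= e ->
  measurable D -> (mu D <= (t * (c * c))%:E)%E ->
  (forall x x', ~ D x -> ~ D x' -> pi x = pi x' ->
    (forall h, h \in H -> P (T h x) = P (T h x')) -> Q x = Q x') ->
  (forall h, h \in H -> 1 - folner_ratio R F h <= e') ->
  c + e' <= e -> t + t + (e' + e') *+ #|` H| <= e ->
  (rel_cov T nu muY Q F e <= rel_cov T nu muY P F e')%E.
Proof.
move=> fac dis mset1 F0 t0 c0 e0 mD muD code folF ce' te'.
have [mpi _ _] := fac.
have [B [mB muB visB]] := visits_small T F0 mD t0 muD.
have [N [mN N0 equiN]] := equivariant_finite F fac.
have muBN : (mu (B `|` N) <= (c * c)%:E)%E by rewrite measureU0.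
have mBN : measurable (B `|` N) by exact: measurableU.
have [Z [mZ nuZ fibZ]] :=
  fibers_small dis mset1 mpi mBN c0 muBN.
apply: (rel_cov_le_rel_cov mZ nuZ ce') => y Zy.
have mfib : measurable (pi @^-1` [set y]).
  by rewrite -[X in measurable X]setTI; exact: mpi.
apply: (cov_le_cov F0 e0 _ (fibZ y Zy) ce').
  by apply: measurableI => //; exact: measurableC.
move=> x x' [/not_orP[nBx nNx] yx] [/not_orP[nBx' nNx'] yx'] Pxx'.
apply: le_trans te'; apply: (hamming_code (D := D) F0 _ folF _ _ Pxx').
- move=> f fF nDx nDx' PH; apply: code PH => //.
  by rewrite equiN// equiN// yx yx'.
- exact: visB.
- exact: visB.
Qed.

Lemma slow_entropy_part_generating (P : nat -> mpartition X) (U : nat -> R)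
    (F : nat -> {fset G}) (Q : mpartition X) :
  standard_borel R Y -> factor_map T S pi -> disintegration mu nu pi muY ->
  (forall m, refines (P m.+1) (P m)) -> generating T pi P ->
  rate_function U -> folner R F ->
  (slow_entropy_part T nu muY U F Q <=
    ereal_sup (range (fun m => slow_entropy_part T nu muY U F (P m))))%E.
Proof.
move=> stdY fac dis Pref gen [U0 _ _] folF; have [mpi _ _] := fac.
apply: slow_entropy_part_le => // e e0.
(* The budget [e] in the Hamming distance is split as [2 t] for the visits to
   the exceptional set and [2 t] for the coding through [H], where
   [e' * (#|H| + 1) = t]; the budget in mass is [c] for the fibres and
   [e' <= e / 4] for the cover that is transferred. *)
pose t := e / 4; pose c := e / 2.
have t0 : 0 < t by rewrite divr_gt0.
have c0 : 0 < c by rewrite divr_gt0.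
have tc0 : 0 < t * (c * c) by rewrite !mulr_gt0.
have [m [H [D [mD muD code]]]] :=
  partition_code Pref mpi Q gen tc0.
pose k : R := #|` H|%:R; have k0 : 0 <= k by rewrite ler0n.
pose e' := t / (k + 1).
have k10 : 0 < k + 1 by rewrite ltr_wpDl.
have e'0 : 0 < e' by rewrite divr_gt0.
have e't : e' *+ #|` H| + e' = t.
  by rewrite -mulr_natr -[X in _ + X]mulr1 -mulrDr /e' mulfVK// gt_eqF.
have e'H0 : 0 <= e' *+ #|` H| by rewrite mulrn_wge0// ltW.
exists (P m), e'; split=> //.
  by apply: ereal_sup_ubound; exists m.
have near_fol := folner_near H folF e'0.
apply: filterS near_fol => n fol_n.
apply: (rel_cov_fiber_code (H := H) (D := D) (t := t) (c := c)) => //.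
- exact: (standard_borel_measurable_set1 stdY).
- by have [] := folF.
- exact: ltW.
- by move=> x x' nDx nDx' pixx' PH; apply: code.
- rewrite /c; move: e't e'H0; rewrite /t => *; lra.
- rewrite mulrnDl; move: e't e'H0; rewrite /t => *; lra.
Qed.

End Generating.

Unset Implicit Arguments.
Set Strict Implicit.

Theorem theorem2p8 (R : realType) (G : groupType)
    (dX dY : measure_display) (X : measurableType dX) (Y : measurableType dY)
    (mu : probability X R) (nu : probability Y R)
    (T : pmp_action G mu) (S : pmp_action G nu)
    (pi : X -> Y) (muY : R.-pker Y ~> X) (P : nat -> mpartition X)
    (G_countable : countable [set: G])
    (G_amenable : amenable R G)
    (X_standard : standard_borel R X)
    (Y_standard : standard_borel R Y)
    (pi_factor : factor_map T S pi)
    (muY_disintegration : disintegration mu nu pi muY)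
    (P_refining : forall m, refines (P m.+1) (P m))
    (P_generating : generating T pi P) :
  forall (U : nat -> R) (F : nat -> {fset G}),
    rate_function U -> folner R F ->
    (slow_entropy_part T nu muY U F (P m) @[m --> \oo]
       --> slow_entropy T nu muY U F) /\
    slow_entropy T nu muY U F =
      ereal_sup (range (fun m => slow_entropy_part T nu muY U F (P m))).
Proof.
move=> U F rateU folF.
have supE : slow_entropy T nu muY U F =
    ereal_sup (range (fun m => slow_entropy_part T nu muY U F (P m))).
  apply/eqP; rewrite eq_le; apply/andP; split.
    apply: ge_ereal_sup => _ [Q _ <-].
    exact: (slow_entropy_part_generating (S := S) (pi := pi)).
  by apply: ge_ereal_sup => _ [m _ <-]; apply: ereal_sup_ubound; exists (P m).
split=> //; rewrite supE; apply: ereal_nondecreasing_cvgn.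
apply/nondecreasing_seqP => m.
by have [U0 _ _] := rateU; have [F0 _] := folF; exact: slow_entropy_part_refines.
Qed.
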